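(* Let $A$ and $B$ be commutative, unital, complex Banach algebras such that $B$ is an integral extension of $A$. If $A$ has dense invertible group then so has $B$.
   Context: An extension of a commutative unital normed algebra $A$ is a commutative unital normed algebra $B$ together with an isometric unital algebra monomorphism $A\to B$, via which $A$ is regarded as a subalgebra of $B$. It is an integral extension if every element of $B$ is a root of a monic polynomial with coefficients in $A$. A unital normed algebra has dense invertible group if its group of invertible elements is a dense subset. *)

(* Defs.v *)
From HB Require Import structures.
From mathcomp Require Import all_boot all_order all_algebra.
From mathcomp Require Export complex.
From mathcomp Require Import boolp classical_sets reals topology normedtype.

Set Implicit Arguments.
Unset Strict Implicit.
Unset Printing Implicit Defensive.

Import Order.TTheory GRing.Theory Num.Theory.

Local Open Scope classical_set_scope.
Local Open Scope ring_scope.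

(* A plain record rather than an HB structure: Hierarchy Builder rejects a join
   of [normedModType] and [algType], since [numDomainType] already inherits from
   both normed Z-modules and rings without a declared common join.  As for
   [normedModType K], the norm takes its values in [K]; nonnegativity follows
   from the axioms below, so over [K := R[i]] norms are real. *)
Record comNormedAlg (K : numFieldType) := ComNormedAlg {
  cna_alg : comAlgType K ;
  cna_norm : cna_alg -> K ;
  cna_ler_normD : forall x y, cna_norm (x + y) <= cna_norm x + cna_norm y ;
  cna_normrZ : forall (l : K) x, cna_norm (l *: x) = `|l| * cna_norm x ;
  cna_normr0_eq0 : forall x, cna_norm x = 0 -> x = 0 ;
  cna_ler_normM : forall x y, cna_norm (x * y) <= cna_norm x * cna_norm y ;
  cna_normr1 : cna_norm 1 = 1
}.

Definition cna_sort (K : numFieldType) (A : comNormedAlg K) : Type := cna_alg A.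

Coercion cna_sort : comNormedAlg >-> Sortclass.

HB.instance Definition _ (K : numFieldType) (A : comNormedAlg K) :=
  GRing.ComAlgebra.copy (cna_sort A) (cna_alg A).

(* The topology and uniformity on [A] are those induced by the norm. *)
HB.instance Definition _ (K : numFieldType) (A : comNormedAlg K) :=
  Lmodule_isNormed.Build K (cna_sort A)
    (@cna_ler_normD K A) (@cna_normrZ K A) (@cna_normr0_eq0 K A).

Record comBanachAlg (K : numFieldType) := ComBanachAlg {
  cba_normed :> comNormedAlg K ;
  cba_complete : forall F : set_system cba_normed,
    ProperFilter F -> cauchy F -> cvg F
}.

(* Existential, because [comAlgType] carries no [GRing.unit] predicate. *)
Definition invertible_elements (K : numFieldType) (A : comNormedAlg K) : set A :=
  [set x | exists y : A, x * y = 1].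

Arguments invertible_elements {K} A.

Definition dense_invertible_group (K : numFieldType) (A : comNormedAlg K) :=
  dense (invertible_elements A).

(* [iota] is a unital algebra morphism; injectivity follows from isometry. *)
Definition extension (K : numFieldType) (A B : comNormedAlg K)
    (iota : {lrmorphism A -> B}) : Prop :=
  forall a : A, `|iota a| = `|a|.

Definition integral_extension (K : numFieldType) (A B : comNormedAlg K)
    (iota : {lrmorphism A -> B}) : Prop :=
  extension iota /\ integralRange iota.

(* Main.v *)
Require Import Defs.
From mathcomp Require Import all_boot all_order all_algebra.
From mathcomp Require Import reals topology normedtype.
From mathcomp Require Import boolp classical_sets.
From mathcomp Require Import ring.

(** Let [b] in [B] be a root of a monic polynomial [p] over [A].  For every [a]
    in [A], the element [b - a] divides [p(b) - p(a) = - p(a)] in [B]; hence if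
    [p(a)] is invertible in [A], then [b - a] is invertible in [B].  It is
    therefore enough to find arbitrarily small [a] in [A] with [p(a)]
    invertible ([small_invertible_value]), a question about [A] alone.

    This is settled by induction on the degree of [p].  Dividing the derivative
    [p'] by the degree makes it monic of smaller degree, so there is a small
    [a] with [p'(a)] invertible.  At such a point the inverse function theorem
    applies: [p] maps every neighbourhood of [a] onto a neighbourhood of [p(a)]
    ([poly_locally_onto]).  By density that neighbourhood contains an
    invertible element, which is then a value of [p] near [a].

    For local surjectivity, write [p(a + h) = p(a) + p'(a) h + q(h) h^2] and
    solve [p(a + h) = p(a) + y] as the fixed point equation
    [h = p'(a)^-1 (y - q(h) h^2)], whose right-hand side is a contraction of a
    small closed ball.  The fixed point exists because [A] is complete. *)

Import Order.TTheory GRing.Theory Num.Theory.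

Local Open Scope ring_scope.

(** A positive element of [R[i]] is real, so this is the Archimedean property
    of [R]. *)
Lemma geometric_half_lt (R : realType) (e : R[i]) :
  0 < e -> exists n : nat, 2^-1 ^+ n < e.
Proof.
case: e => x y; rewrite ltcE /= => /andP[/eqP -> x0].
exists (Num.bound x^-1).
have -> : 2^-1 ^+ Num.bound x^-1 = ((2^-1 ^+ Num.bound x^-1)%:C)%C :> R[i].
  by rewrite rmorphXn /= fmorphV rmorph_nat.
rewrite ltcR exprVn invf_plt ?posrE ?exprn_gt0 //.
apply: lt_le_trans (archi_boundP _) _; first by rewrite invr_ge0 ltW.
by rewrite -natrX ler_nat ltnW // ltn_expl.
Qed.

Section NormedAlgebra.
Context {K : numFieldType} {A : comNormedAlg K}.
Implicit Types (a b c h k y : A) (p q : {poly A}).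

Lemma normM_le a b : `|a * b| <= `|a| * `|b|.
Proof. exact: cna_ler_normM. Qed.

Lemma denseP (S : set A) :
  dense S <-> forall a (e : K), 0 < e -> exists2 s, S s & `|a - s| < e.
Proof.
split=> [dS a e e0|dS U [a Ua]].
  have [|s [+ Ss]] := dS (ball a e)° %classic _ (@open_interior _ _).
    by exists a; apply: nbhsx_ballx.
  by move=> /interior_subset; rewrite -ball_normE; exists s.
rewrite openE => /(_ _ Ua) /nbhs_ballP[e /= e0 aeU].
have [s Ss ase] := dS a e e0.
by exists s; split=> //; apply: aeU; rewrite -ball_normE.
Qed.

(** The bound and the Lipschitz constant are carried by the same [M] because the
    induction step for the Lipschitz constant of [q * 'X] needs the bound on
    [q]. *)
Lemma poly_lipschitz_unit_ball q :
  exists2 M : K, 0 <= M & forall h k, `|h| <= 1 -> `|k| <= 1 ->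
    `|q.[h]| <= M /\ `|q.[h] - q.[k]| <= M * `|h - k|.
Proof.
elim/poly_ind: q => [|q c [M M0 IH]].
  by exists 0 => // h k _ _; rewrite !horner0 subrr normr0 mul0r.
exists (M + M + `|c|) => [|h k h1 k1]; first by rewrite !addr_ge0.
have [[qh qhk] [qk _]] := (IH h k h1 k1, IH k h k1 h1).
rewrite !hornerE; split.
  apply: le_trans (ler_normD _ _) _; rewrite lerD2r.
  apply: le_trans (normM_le _ _) _.
  apply: (@le_trans _ _ (M * 1)); first by rewrite ler_pM.
  by rewrite mulr1 lerDl.
have -> : q.[h] * h + c - (q.[k] * k + c)
  = (q.[h] - q.[k]) * h + q.[k] * (h - k) by ring.
apply: le_trans (ler_normD _ _) _.
apply: (@le_trans _ _ (M * `|h - k| + M * `|h - k|)); last first.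
  by rewrite -mulrDl ler_wpM2r // lerDl.
apply: lerD; apply: le_trans (normM_le _ _) _; last by rewrite ler_wpM2r.
by rewrite -[leRHS]mulr1 ler_pM.
Qed.

(** The factor [h ^+ 2] makes the Lipschitz constant on the ball of radius [r]
    at most [3 M r] for [r <= 1], where [M] is the constant of [q] on the unit
    ball. *)
Lemma poly_sqr_contraction q (e : K) : 0 < e ->
  exists r : K, [/\ 0 < r, r <= e & forall h k, `|h| <= r -> `|k| <= r ->
    `|q.[h] * h ^+ 2 - q.[k] * k ^+ 2| <= 2^-1 * `|h - k|].
Proof.
move=> e0; have [M M0 qM] := poly_lipschitz_unit_ball q.
(* The radius [e / d] is at most [e] and [1], and at most [(6 M)^-1] if [M] is
   positive; the explicit quotient avoids minima in the partial order of [K]. *)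
set d : K := (1 + e) * (1 + 6 * M).
have e1 : 1 <= 1 + e by rewrite lerDl ltW.
have m1 : 1 <= 1 + 6 * M by rewrite lerDl mulr_ge0.
have ed : 1 + e <= d by rewrite ler_peMr // (le_trans ler01).
have d0 : 0 < d by rewrite (lt_le_trans _ ed) // (lt_le_trans ltr01).
have r0 : 0 < e / d by rewrite divr_gt0.
have r1 : e / d <= 1.
  by rewrite ler_pdivrMr // mul1r (le_trans _ ed) // lerDr.
exists (e / d); split=> // [|h k hr kr].
  by rewrite ler_pdivrMr // ler_peMr ?ltW // (lt_le_trans _ ed) // ltrDl.
have [qh qhk] := qM h k (le_trans hr r1) (le_trans kr r1).
have [qk _] := qM k h (le_trans kr r1) (le_trans hr r1).
have -> : q.[h] * h ^+ 2 - q.[k] * k ^+ 2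
  = (q.[h] - q.[k]) * (h * h) + q.[k] * (h + k) * (h - k) by ring.
set r := e / d in hr kr r0 r1 *.
have rM : 3 * M * r <= 2^-1.
  rewrite /r mulrA ler_pdivrMr // ler_pdivlMl //.
  rewrite (_ : 2 * (3 * M * e) = e * (6 * M)); last by ring.
  by rewrite ler_pM ?mulr_ge0 ?lerDr // ltW.
apply: le_trans (ler_normD _ _) _.
apply: (@le_trans _ _ (M * `|h - k| * r + M * (r + r) * `|h - k|)); last first.
  rewrite (_ : _ + _ = 3 * M * r * `|h - k|); last by ring.
  by rewrite ler_wpM2r.
apply: lerD; apply: le_trans (normM_le _ _) _.
  rewrite ler_pM // (le_trans (normM_le _ _)) // -[r]mulr1 ler_pM //.
  exact: le_trans r1.
rewrite ler_wpM2r // (le_trans (normM_le _ _)) // ler_pM //.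
by apply: le_trans (ler_normD _ _) _; apply: lerD.
Qed.

Lemma poly_taylor2 p a :
  exists q, forall h, p.[a + h] = p.[a] + p^`().[a] * h + q.[h] * h ^+ 2.
Proof.
elim/poly_ind: p => [|p c [q pq]].
  by exists 0 => h; rewrite deriv0 !horner0; ring.
exists (q * ('X + a%:P) + (p^`().[a])%:P) => h.
by rewrite derivMXaddC !(hornerD, hornerM, hornerX, hornerC) pq; ring.
Qed.

End NormedAlgebra.

Section BanachAlgebra.
Context {R : realType} {A : comBanachAlg R[i]}.
Implicit Types (a c h k y : A) (p : {poly A}) (e r : R[i]).

(** The Banach fixed point theorem over [R[i]], for the orbit of the centre [0]
    of the ball.  Contraction propagates the bound [`|u m - u 0| <= r] along the
    orbit, which gives the Cauchy estimate directly, with no geometric sum. *)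
Lemma banach_fixpoint_closed_ball (phi : A -> A) r : 0 <= r ->
  (forall h, `|h| <= r -> `|phi h| <= r) ->
  (forall h k, `|h| <= r -> `|k| <= r ->
     `|phi h - phi k| <= 2^-1 * `|h - k|) ->
  exists2 h, `|h| <= r & phi h = h.
Proof.
move=> r0 phir phiC; pose u n := iter n phi 0.
have ur n : `|u n| <= r by elim: n => [|n IH]; rewrite /u /= ?normr0 // phir.
have ucauchy n m : `|u (n + m)%N - u n| <= 2^-1 ^+ n * r.
  elim: n => [|n IH]; first by rewrite expr0 mul1r subr0.
  rewrite addSn /u /= exprS -mulrA (le_trans (phiC _ _ (ur _) (ur _))) //.
  by rewrite ler_wpM2l ?invr_ge0 //; exact: IH.
have small e : 0 < e -> exists N, forall n m, (N <= n)%N -> (N <= m)%N ->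
    `|u n - u m| < e.
  move=> e0; have [|N Ne] := @geometric_half_lt R (e / 2 / (1 + r)).
    by rewrite !divr_gt0 // ltr_pwDl.
  have uN n : (N <= n)%N -> `|u n - u N| < e / 2.
    move=> /subnKC <-; apply: le_lt_trans (ucauchy _ _) _.
    move: Ne; rewrite ltr_pdivlMr ?ltr_pwDl //; apply: le_lt_trans.
    by rewrite ler_wpM2l ?exprn_ge0 ?invr_ge0 ?lerDr.
  exists N => n m Nn Nm; rewrite (splitr e).
  rewrite (_ : u n - u m = (u n - u N) + (u N - u m)); last by ring.
  by apply: le_lt_trans (ler_normD _ _) _; rewrite ltrD ?uN // distrC uN.
have : cvg (u @ \oo)%classic.
  apply: cba_complete; apply/cauchy_ballP => e e0.
  have [N uN] := small e e0.
  exists (u @` [set n | (N <= n)%N], u @` [set n | (N <= n)%N])%classic.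
    by split; exists N => // n /= Nn; exists n.
  by move=> [_ _] /= [[n Nn <-] [m Nm <-]]; rewrite -ball_normE; apply: uN.
move=> /cvg_ex[l /cvgrPdist_lt ul].
have near_l e : 0 < e -> exists n, `|l - u n| < e /\ `|l - u n.+1| < e.
  by move=> /ul[N _ lN]; exists N; split; apply: lN => /=.
have lr : `|l| <= r.
  apply/ler_addgt0Pr => e /near_l[n [lun _]].
  rewrite -[l](subrK (u n)) (le_trans (ler_normD _ _)) // addrC.
  by rewrite lerD // ltW.
exists l => //; apply/eqP; rewrite -subr_eq0 -normr_le0.
apply/ler_addgt0Pr => e e0; rewrite add0r.
have [|n [lun lun1]] := near_l (e / 2); first by rewrite divr_gt0.
rewrite (_ : phi l - l = (phi l - u n.+1) + (u n.+1 - l)); last by ring.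
rewrite (le_trans (ler_normD _ _)) // [leRHS]splitr lerD //; last first.
  by rewrite distrC ltW.
apply: le_trans (phiC _ _ lr (ur n)) _.
apply: le_trans (ltW lun); rewrite ler_piMl // invf_le1 ?ler1n ?ltr0n //.
Qed.

(** The surjectivity half of the inverse function theorem for a polynomial map;
    [c] is the inverse of [p'(a)]. *)
Lemma poly_locally_onto p a c e : p^`().[a] * c = 1 -> 0 < e ->
  exists2 d : R[i], 0 < d & forall y, `|y| < d ->
    exists2 h, `|h| <= e & p.[a + h] = p.[a] + y.
Proof.
move=> pac e0; have [q pq] := poly_taylor2 p a.
have [r [r0 re qr]] := poly_sqr_contraction (c%:P * q) _ e0.
have c1 : 0 < 1 + `|c| by rewrite ltr_pwDl.
(* The quadratic term at most halves norms, so the ball of radius [r] is mapped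
   into itself as soon as [`|c * y| <= r / 2]. *)
exists (r / 2 / (1 + `|c|)) => [|y yd]; first by rewrite !divr_gt0.
have cy : `|c * y| <= r / 2.
  apply: le_trans (normM_le _ _) _; rewrite mulrC.
  move: yd; rewrite ltr_pdivlMr // => /ltW; apply: le_trans.
  by rewrite ler_wpM2l // lerDr.
have [h hr|h k hr kr|h hr hE] := @banach_fixpoint_closed_ball
    (fun h => c * y - (c%:P * q).[h] * h ^+ 2) r (ltW r0).
- rewrite (le_trans (ler_normB _ _)) // [leRHS]splitr lerD //.
  have := qr h 0 hr; rewrite normr0 expr0n mulr0 !subr0 => /(_ (ltW r0)) qh.
  by rewrite (le_trans qh) // mulrC ler_wpM2r ?invr_ge0.
- rewrite (_ : _ - _ =
    (c%:P * q).[k] * k ^+ 2 - (c%:P * q).[h] * h ^+ 2); last by ring.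
  by rewrite [`|h - k|]distrC qr.
exists h; first exact: le_trans re.
move: hE; rewrite hornerM hornerC => hE.
have {}hE : c * (y - q.[h] * h ^+ 2) = h by rewrite -[RHS]hE; ring.
by rewrite pq -{1}hE mulrA pac mul1r addrA addrNK.
Qed.

(** The induction is on the degree: an invertible value of the derivative near
    [0] makes [p] locally onto there, and density supplies an invertible value
    of [p].  Dividing by the degree is possible because [A] is an algebra over
    a field of characteristic zero. *)
Lemma small_invertible_value p e :
  dense_invertible_group A -> p \is monic -> 0 < e ->
  exists2 a, `|a| < e & invertible_elements A p.[a].
Proof.
move=> dA; have [n] := ubnP (size p); elim: n p e => // n IH p e sp pm e0.
have [p1|p_gt1] := leqP (size p) 1.
  exists 0; first by rewrite normr0.
  have -> : p = 1.
    by move: pm; rewrite [p]size1_polyC // monicE lead_coefC => /eqP ->.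
  by exists 1; rewrite hornerC mulr1.
have [m sm] : exists m, size p = m.+2.
  by case: (size p) p_gt1 => [|[|m]] // _; exists m.
have m0 : m.+1%:R != 0 :> R[i] by rewrite pnatr_eq0.
pose u : A := (m.+1%:R^-1 : R[i])%:A.
have um : u * m.+1%:R = 1.
  by rewrite mulr_natr -scaler_nat scalerA mulfV // scale1r.
have e20 : 0 < e / 2 by rewrite divr_gt0.
pose q := u%:P * p^`().
have lead : q`_m = 1.
  rewrite /q coefCM coef_deriv.
  by move: pm; rewrite monicE lead_coefE sm => /eqP ->.
have sz : (size q <= m.+1)%N.
  rewrite /q mul_polyC (leq_trans (size_scale_leq _ _)) // -ltnS -sm.
  by rewrite lt_size_deriv // -size_poly_gt0 sm.
have dm : q \is monic.
  rewrite monicE lead_coefE.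
  have -> : size q = m.+1; last by rewrite lead.
  apply/eqP; rewrite eqn_leq sz ltnNge /=.
  by apply/leq_sizeP => /(_ _ (leqnn _)) /eqP; rewrite lead oner_eq0.
have [|a ae [y pay]] := IH q (e / 2) _ dm e20.
  by rewrite (leq_ltn_trans sz) // -ltnS -sm.
have [|d d0 ponto] := @poly_locally_onto p a (u * y) (e / 2) _ e20.
  by rewrite -pay /q hornerM hornerC; ring.
have /denseP/(_ p.[a] d d0)[s s_inv pas] := dA.
have [|h he pah] := ponto (s - p.[a]); first by rewrite distrC.
exists (a + h); last by rewrite pah addrC subrK.
by rewrite (le_lt_trans (ler_normD _ _)) // [ltRHS]splitr ltr_leD.
Qed.

End BanachAlgebra.

Theorem theorem4p2p2p3 (R : realType) (A B : comBanachAlg R[i])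
    (iota : {lrmorphism A -> B}) :
  integral_extension iota ->
  dense_invertible_group A -> dense_invertible_group B.
Proof.
move=> [iota_isom iota_int] dA; apply/denseP => b e e0.
have [p p_monic /factor_theorem[q pq]] := iota_int b.
have [a ae [y pay]] := small_invertible_value _ _ dA p_monic e0.
exists (b - iota a); last by rewrite subKr iota_isom.
exists (- (q.[iota a] * iota y)).
have := congr1 iota pay.
rewrite rmorphM rmorph1 -horner_map /= pq !hornerE => <-.
ring.
Qed.
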